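(* An $H$-MBQC $\mathcal{M}$ with resource state $\rho$, input group $Q$, output function $o:Q\to\mathbb{Z}_2$ and average success probability $\overline{P}_o(\rho)$ is contextual if $$\overline{P}_o(\rho)>1-\frac{\mathbb{H}^*(o,\Lambda_{\mathcal{O}})}{|Q|}.$$
   Context: Observables. Fix a finite-dimensional Hilbert space. $\mathcal{O}$ is a set of observables (Hermitian operators with eigenvalues $\pm1$ only) with $A\in\mathcal{O}\Leftrightarrow -A\in\mathcal{O}$. A resolution of an observable $X$ in $\mathcal{O}$ is a product $X=A_1(A_2(\cdots(A_{K-1}A_K)))$, $K\ge 1$, $A_i\in\mathcal{O}$, such that with $B_i:=\prod_{l=i+1}^K A_l$ (in this order) $[A_i,B_i]=0$ for $i=1,\dots,K-1$. $\mathcal{I}$ is the set of all observables having a resolution in $\mathcal{O}$; it is closed under $A\mapsto -A$. $E$ is the set of classes $\{A,-A\}$, $A\in\mathcal{I}$; for each $a\in E$ a representative $T_a\in\mathcal{I}$ is fixed, so $\mathcal{I}=\{\pm T_a: a\in E\}$. $E_{\mathcal{O}}:=\{a\in E: T_a\in\mathcal{O}\}$. For $a\in E_{\mathcal{O}}$, $b\in E$ with $[T_a,T_b]=0$, $a\oplus b\in E$ is defined by $T_{a\oplus b}=\pm T_aT_b$. $H$-MBQC. $Q$ is a finite group acting on $E$ such that $qa\in E_{\mathcal{O}}$ for $a\in E_{\mathcal{O}}$, and $q(a\oplus b)=qa\oplus qb$ whenever $a\oplus b$ is defined. A sequence of distinct edges $a_1,\dots,a_n\in E_{\mathcal{O}}$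 is fixed such that $a_{\rm e}:=a_1\oplus(a_2\oplus\cdots\oplus(a_{n-1}\oplus a_n))$ is defined. On input $q\in Q$, the observables $T_{qa_1},\dots,T_{qa_n}$ are measured (projectively, sequentially) on the resource state $\rho$ with outcomes $s(qa_i)\in\mathbb{Z}_2$, and $\sum_i s(qa_i)\bmod2$ is output. The average success probability is the probability that the output equals $o(q)$, averaged uniformly over $q\in Q$: $$\overline{P}_o(\rho)=\frac1{|Q|}\sum_{q\in Q}\mathrm{Tr}\Big(\rho\,\tfrac12\big(I+(-1)^{o(q)}T_{qa_1}T_{qa_2}\cdots T_{qa_n}\big)\Big).$$ (An $H$-MBQC also carries a symmetry group $H$ acting on $\mathcal{I}$ by maps $h$ with $h(-A)=-h(A)$, $h(\mathcal{O})\subset\mathcal{O}$, $h(AB)=h(A)h(B)$ for commuting $A,B\in\mathcal{I}$ with $AB\in\mathcal{I}$, and preserving the set $\{(-1)^{o(q)}\prod_iT_{qa_i}: q\in Q\}$; $Q=H/N$ where $N$ is the kernel of the induced action of $H$ on $E$.) Contextuality. Two observables $A,B$ are jointly measurable if $A\in\mathcal{O}$, $B\in\mathcal{I}$ and $[A,B]=0$; then $\{A,B,AB\}$ is a set of jointly measurable observables. A non-contextual hidden variable model (ncHVM) for $(\rho,\mathcal{I})$ is a triple $(\Omega,q_\rho,\Lambda)$ with $q_\rho$ a probability distribution on a set $\Omega$ and $\Lambda=\{\lambda_\nu\}_{\nu\in\Omega}$ a family of functions $\lambda_\nu:\mathcal{I}\to\mathbb{C}$ such that (1) for every set $S\subset\mathcal{I}$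 of jointly measurable observables (i.e. every set $S=\{A,B,AB\}$ with $A\in\mathcal{O}$, $B\in\mathcal{I}$ and $[A,B]=0$) and every $\nu$ there is a quantum state (nonzero vector) $|\psi\rangle$ with $X|\psi\rangle=\lambda_\nu(X)|\psi\rangle$ for all $X\in S$; (2) $\mathrm{Tr}(A\rho)=\sum_{\nu\in\Omega}\lambda_\nu(A)q_\rho(\nu)$ for all $A\in\mathcal{I}$. $\mathcal{M}$ is contextual if no ncHVM for $(\rho,\mathcal{I})$ exists. Hamming distance. $\Lambda_{\mathcal{O}}$ is the set of all functions $s:E_{\mathcal{O}}\to\mathbb{Z}_2$; $\mathbb{H}(o,o')$ is the number of $q\in Q$ with $o(q)\ne o'(q)$; for $s\in\Lambda_{\mathcal{O}}$ write $s(q\,\partial_Rf_{\rm e}):=\sum_{i=1}^ns(qa_i)$; and $$\mathbb{H}^*(o,\Lambda_{\mathcal{O}}):=\min_{c\in\mathbb{Z}_2}\min_{s\in\Lambda_{\mathcal{O}}}\mathbb{H}\big(o(\cdot)+c,\ s(\,\cdot\,\partial_Rf_{\rm e})\big).$$ *)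

(* Defs.v *)
(* MathComp / MathComp-Analysis world. *)
From HB Require Import structures.
From mathcomp Require Import all_boot all_order all_algebra all_fingroup.
From mathcomp Require Import sesquilinear spectral complex finmap.
From mathcomp Require Import boolp classical_sets reals topology normedtype.
From mathcomp Require Import summability.

Set Implicit Arguments.
Unset Strict Implicit.
Unset Printing Implicit Defensive.

Import Order.TTheory GRing.Theory Num.Theory numFieldNormedType.Exports.

Local Open Scope classical_set_scope.
Local Open Scope sesquilinear_scope.
Local Open Scope complex_scope.
Local Open Scope ring_scope.

(* Unconditional summation over an arbitrary index set: convergence of the net
   of partial sums over finite subsets. It is used at K := R and K := R[i]. *)
Definition has_sum (K : numFieldType) (I : choiceType) (u : I -> K) (l : K) :
  Prop := partial_sum u @ totally --> l.

(* The Hilbert space is C^d with C = R[i]; operators are d x d matrices and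
   kets are column vectors. *)
Section Observables.
Variables (R : realType) (d : nat).
Local Notation M := 'M[R[i]]_d.
Implicit Types (O : set M) (A X : M).

Definition observable A : Prop :=
  A \is hermsymmx /\ forall a, eigenvalue A a -> a = 1 \/ a = -1.

Definition density_operator (rho : M) : Prop :=
  [/\ rho \is hermsymmx,
      forall v : 'cV[R[i]]_d, 0 <= (v ^t* *m rho *m v) 0 0 &
      \tr rho = 1].

(* s = [:: A_1; ...; A_K] with K >= 1, and A_i commutes with the product
   B_i = A_{i+1} ... A_K for i < K (s is indexed from 0). *)
Definition resolution O X (s : seq M) : Prop :=
  [/\ s != [::],
      forall A, A \in s -> O A,
      X = \prod_(A <- s) A &
      forall i, (i.+1 < size s)%N ->
        comm_mx s`_i (\prod_(A <- drop i.+1 s) A)].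

(* The set I of observables that have a resolution in O. *)
Definition inferable O : set M :=
  [set X | observable X /\ exists s, resolution O X s].

(* The set E of the classes {A, -A}, A in I. *)
Definition edges O : set (set M) :=
  [set [set A; - A] | A in inferable O].

(* The set E_O, for T a choice of representatives of the classes. *)
Definition gen_edges O (T : set M -> M) : set (set M) :=
  [set a | edges O a /\ O (T a)].

(* The partial operation (+) as its graph: [oplus O T a b c] means that
   a (+) b is defined and equal to c. *)
Definition oplus O (T : set M -> M) (a b c : set M) : Prop :=
  [/\ gen_edges O T a, edges O b, edges O c,
      comm_mx (T a) (T b) &
      T c = T a *m T b \/ T c = - (T a *m T b)].

(* a_1 (+) (a_2 (+) ... (a_{n-1} (+) a_n)) is defined and equal to c. *)
Fixpoint oplus_seq O (T : set M -> M) (s : seq (set M)) (c : set M) : Prop :=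
  match s with
  | [::] => False
  | [:: a] => c = a
  | a :: s' => exists2 e, oplus_seq O T s' e & oplus O T a e c
  end.

End Observables.

(* Maps on I or on E are represented by total functions on matrices or on sets
   of matrices; they are constrained, and used, only on I or on E.
   Q = H / N is presented by a surjective morphism proj : H -> Q whose kernel
   is the kernel N of the action of H on E, where h maps {A, -A} to its image
   {h A, h (-A)}. *)
Record hmbqc (R : realType) (d : nat) (H : groupType) (Q : finGroupType) := {
  gen : set 'M[R[i]]_d;
  gen_observable : forall A, gen A -> observable A;
  gen_opp : forall A, gen A <-> gen (- A);

  rep : set 'M[R[i]]_d -> 'M[R[i]]_d;
  rep_mem : forall a, edges gen a -> a (rep a);

  qact : Q -> set 'M[R[i]]_d -> set 'M[R[i]]_d;
  qact_edges : forall q a, edges gen a -> edges gen (qact q a);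
  qact1 : forall a, edges gen a -> qact 1%g a = a;
  qactM : forall q r a, edges gen a -> qact (q * r)%g a = qact q (qact r a);
  qact_gen : forall q a, gen_edges gen rep a -> gen_edges gen rep (qact q a);
  qact_oplus : forall q a b c, oplus gen rep a b c ->
    oplus gen rep (qact q a) (qact q b) (qact q c);

  measured : seq (set 'M[R[i]]_d);
  measured_uniq : uniq measured;
  measured_gen : forall a, a \in measured -> gen_edges gen rep a;
  measured_oplus : exists e, oplus_seq gen rep measured e;

  outfun : Q -> 'Z_2;

  rho : 'M[R[i]]_d;
  rho_state : density_operator rho;

  hact : H -> 'M[R[i]]_d -> 'M[R[i]]_d;
  hact_inferable : forall h A, inferable gen A -> inferable gen (hact h A);
  hact1 : forall A, inferable gen A -> hact 1%g A = A;
  hactM : forall g h A, inferable gen A ->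
    hact (g * h)%g A = hact g (hact h A);
  hact_opp : forall h A, inferable gen A -> hact h (- A) = - hact h A;
  hact_gen : forall h A, gen A -> gen (hact h A);
  hact_mul : forall h A B, inferable gen A -> inferable gen B ->
    comm_mx A B -> inferable gen (A *m B) ->
    hact h (A *m B) = hact h A *m hact h B;
  hact_outputs : forall h,
    let outputs := [set (-1) ^+ outfun q *: \prod_(a <- measured) rep (qact q a)
                   | q in [set: Q]] in
    hact h @` outputs = outputs;

  proj : {multiplicative H -> Q};
  proj_surj : forall q, exists h, proj h = q;
  proj_qact : forall h a, edges gen a -> qact (proj h) a = hact h @` a;
  proj_ker : forall h,
    proj h = 1%g <-> forall a, edges gen a -> hact h @` a = a
}.

Section Contextuality.
Variables (R : realType) (d : nat) (H : groupType) (Q : finGroupType).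
Variable MB : hmbqc R d H Q.
Local Notation M := 'M[R[i]]_d.

(* The traces below are real, so taking real parts loses nothing. *)
Definition avg_success : R :=
  #|Q|%:R^-1 * \sum_(q : Q) complex.Re (\tr (rho MB *m (2^-1 *:
    (1%:M + (-1) ^+ outfun MB q *:
              \prod_(a <- measured MB) rep MB (qact MB q a))))).

(* Non-contextual hidden variable models for (rho, I). The distribution is
   discrete, on an arbitrary set, as the model expresses expectation values as
   sums over that set. *)
Definition is_ncHVM (Omega : choiceType) (p : Omega -> R)
    (lambda : Omega -> M -> R[i]) : Prop :=
  [/\ forall nu, 0 <= p nu,
      has_sum p 1,
      forall nu A B, gen MB A -> inferable (gen MB) B -> comm_mx A B ->
        exists psi : 'cV[R[i]]_d,
          psi != 0 /\
          forall X, [set A; B; A *m B] X -> X *m psi = lambda nu X *: psi &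
      forall A, inferable (gen MB) A ->
        has_sum (fun nu => lambda nu A * (p nu)%:C) (\tr (A *m rho MB))].

Definition contextual : Prop :=
  ~ exists (Omega : choiceType) (p : Omega -> R) (lambda : Omega -> M -> R[i]),
      is_ncHVM p lambda.

Definition hamming (o o' : Q -> 'Z_2) : nat := #|[pred q | o q != o' q]|.

(* s(q d_R f_e); only the values of s on E_O are used. *)
Definition output_parity (s : set M -> 'Z_2) (q : Q) : 'Z_2 :=
  \sum_(a <- measured MB) s (qact MB q a).

Definition hamming_value (k : nat) : Prop :=
  exists (c : 'Z_2) (s : set M -> 'Z_2),
    k = hamming (fun q => outfun MB q + c) (output_parity s).

Lemma hamming_value_ex : exists k, `[< hamming_value k >].
Proof.
by exists (hamming (fun q => outfun MB q + 0) (output_parity (fun=> 0)));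
   apply/asboolP; exists 0, (fun=> 0).
Qed.

(* H^*(o, Lambda_O), the minimum over c and s. *)
Definition hamming_star : nat := ex_minn hamming_value_ex.

End Contextuality.

(* Main.v *)
Require Import Defs.
From mathcomp Require Import all_boot all_order all_algebra all_fingroup.
From mathcomp Require Import reals.
From mathcomp Require Import sesquilinear complex finmap.
From mathcomp Require Import boolp classical_sets topology normedtype.
From mathcomp Require Import summability.

(* In a hidden variable model every lambda_nu is multiplicative on jointly
   measurable pairs and takes values +1 and -1 on O, so that, peeling off the
   factors of the iterated sum a_1 (+) (a_2 (+) ...), it maps
   T_{q a_1} ... T_{q a_n} to (-1) ^ s_nu(q d_R f_e) for some
   s_nu : E_O -> Z_2. The model thus succeeds on average with probability
   sum_nu p(nu) (1 - H(o, s_nu) / |Q|), which is at most 1 - H^* / |Q|. *)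

Set Implicit Arguments.
Unset Strict Implicit.
Unset Printing Implicit Defensive.

Import Order.TTheory GRing.Theory Num.Theory numFieldNormedType.Exports.

Local Open Scope sesquilinear_scope.
Local Open Scope ring_scope.

(** * Unconditional sums over an arbitrary index set *)

Section HasSum.
Variables (R : realType) (I : choiceType).

#[local] Existing Instance totally_filter.

(** The model states expectation values as complex sums, while the success probability is real. [Re]
    is additive and bounded by the modulus, so it commutes with the limit. *)
Lemma has_sum_Re (u : I -> R[i]) (l : R[i]) :
  has_sum u l -> has_sum (fun i => complex.Re (u i)) (complex.Re l).
Proof.
move=> /cvgrPdist_lt ul; apply/cvgrPdist_lt => e e0.
have /ul : 0 < e%:C%C by rewrite ltcR.
apply: filterS => J.
have ReB (x y : R[i]) : complex.Re (x - y) = complex.Re x - complex.Re y.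
  by case: x y => [? ?] [].
have ReD (x y : R[i]) : complex.Re (x + y) = complex.Re x + complex.Re y.
  by case: x y => [? ?] [].
have -> : partial_sum (fun i => complex.Re (u i)) J
        = complex.Re (partial_sum u J).
  by rewrite /partial_sum (big_morph _ ReD (erefl _)).
rewrite -ReB => lt_e; rewrite -ltcR.
exact: le_lt_trans (normc_ge_Re _) lt_e.
Qed.

Lemma has_sumZ (c : R) (u : I -> R) (l : R) :
  has_sum u l -> has_sum (fun i => c * u i) (c * l).
Proof.
move=> ul; rewrite /has_sum.
have -> : partial_sum (fun i => c * u i) = (fun J => c * partial_sum u J).
  by apply/funext => J; rewrite /partial_sum mulr_sumr.
exact: cvgMl_tmp ul.
Qed.

Lemma has_sumD (u v : I -> R) (l m : R) :
  has_sum u l -> has_sum v m -> has_sum (fun i => u i + v i) (l + m).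
Proof.
move=> ul vm; rewrite /has_sum.
have -> : partial_sum (fun i => u i + v i)
        = (fun J => partial_sum u J + partial_sum v J).
  by apply/funext => J; rewrite /partial_sum big_split.
exact: cvgD ul vm.
Qed.

(** Serves to exchange the finite sum over inputs with the sum over hidden variables. *)
Lemma has_sum_sum (J : finType) (u : J -> I -> R) (l : J -> R) :
  (forall j, has_sum (u j) (l j)) ->
  has_sum (fun i => \sum_j u j i) (\sum_j l j).
Proof.
move=> ul; rewrite /has_sum.
have -> : partial_sum (fun i => \sum_j u j i)
        = (fun A => \sum_j partial_sum (u j) A).
  by apply/funext => A; rewrite /partial_sum exchange_big.
apply: cvg_big => [|j _]; [exact: add_continuous | exact: ul].
Qed.

Lemma ler_has_sum (u v : I -> R) (l m : R) :
  (forall i, u i <= v i) -> has_sum u l -> has_sum v m -> l <= m.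
Proof.
move=> uv ul vm; rewrite -subr_ge0; apply: (cvgr_to_ge (cvgB vm ul)).
by apply: filterE => J; rewrite subr_ge0 /partial_sum ler_sum.
Qed.

End HasSum.

(** * Observables, resolutions and value assignments *)

Section Observables.
Variables (R : realType) (d : nat).
Implicit Types (A B : 'M[R[i]]_d) (O : set 'M[R[i]]_d).

Lemma observableN A : observable A -> observable (- A).
Proof.
move=> [herm eigA]; split.
  move: herm; rewrite !is_hermitianmxE !expr0 !scale1r => /eqP {1}->.
  by rewrite linearN /= map_mxN.
move=> a /eigenvalueP [v vA v0].
have /eigA [/(canRL opprK)|/oppr_inj] : eigenvalue A (- a).
- by apply/eigenvalueP; exists v; rewrite // scaleNr -vA mulmxN opprK.
- by right.
- by left.
Qed.

(* [eigenvalue] refers to row vectors; for a Hermitian matrix the conjugate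
   transpose turns columns into rows. *)
Lemma observable_col_eigen A (psi : 'cV[R[i]]_d) (l : R[i]) :
  observable A -> psi != 0 -> A *m psi = l *: psi -> l = 1 \/ l = -1.
Proof.
move=> [herm eigA] psi0 Apsi.
have At : A ^t* = A.
  by move: herm; rewrite is_hermitianmxE expr0 scale1r => /eqP.
have /eigA : eigenvalue A l^*.
  apply/eigenvalueP; exists (psi ^t*).
    by rewrite -{1}At -map_mxM -trmx_mul Apsi linearZ /= map_mxZ.
  by rewrite map_mx_eq0 trmx_eq0.
case=> /(congr1 Num.conj); rewrite conjCK => ->.
- by left; rewrite rmorph1.
- by right; rewrite rmorphN1.
Qed.

Lemma gen_inferable O A : observable A -> O A -> inferable O A.
Proof.
move=> obsA OA; split=> //; exists [:: A]; split=> //.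
- by move=> B; rewrite inE => /eqP->.
- by rewrite big_seq1.
Qed.

(** Negating only the first factor of a resolution suffices: the tail products never contain that
    factor, and a sign does not affect its commutation with the first of them. *)
Lemma inferableN O A :
  (forall B, O B -> O (- B)) -> inferable O A -> inferable O (- A).
Proof.
move=> ON [obsA [[|B s] [] // _ sO defA comm]].
split; first exact: observableN.
exists (- B :: s); split=> //.
- move=> C; rewrite inE => /orP[/eqP->|sC].
    by apply: ON; apply: sO; rewrite mem_head.
  by apply: sO; rewrite inE sC orbT.
- by rewrite defA !big_cons mulNr.
- case=> [|i] /comm //=.
  by rewrite /comm_mx mulNmx mulmxN => ->.
Qed.

Lemma inferable_rep O (T : set 'M[R[i]]_d -> 'M[R[i]]_d) (a : set 'M[R[i]]_d) :
    (forall B, O B -> O (- B)) -> (forall b, edges O b -> b (T b)) ->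
  edges O a -> inferable O (T a).
Proof.
move=> ON Tmem aE; have := Tmem _ aE; case: (aE) => A Ainf <- [->|->] //.
exact: inferableN.
Qed.

(* The compatibility condition (1) on a single hidden variable. *)
Definition value_assignment O (l : 'M[R[i]]_d -> R[i]) : Prop :=
  forall A B, O A -> inferable O B -> comm_mx A B ->
    exists psi : 'cV[R[i]]_d, psi != 0 /\
      forall X, [set A; B; A *m B]%classic X -> X *m psi = l X *: psi.

(** On a common eigenvector [psi] of A, B and AB, the product acts both by [l (A *m B)] and by
    [l A * l B]; as [psi] is nonzero, the two scalars agree. *)
Lemma value_assignmentM O (l : 'M[R[i]]_d -> R[i]) A B :
    value_assignment O l -> O A -> inferable O B -> comm_mx A B ->
  l (A *m B) = l A * l B.
Proof.
move=> lP OA infB cAB; have [psi [psi0 eig]] := lP A B OA infB cAB.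
have eA : A *m psi = l A *: psi by apply: eig; left; left.
have eB : B *m psi = l B *: psi by apply: eig; left; right.
have eAB : (A *m B) *m psi = l (A *m B) *: psi by apply: eig; right.
apply/eqP; rewrite -subr_eq0; apply/eqP.
have /eqP : (l (A *m B) - l A * l B) *: psi = 0.
  by rewrite scalerBl -eAB -mulmxA eB -scalemxAr eA scalerA mulrC subrr.
by rewrite scaler_eq0 (negPf psi0) orbF => /eqP.
Qed.

Lemma value_assignment_sign O (l : 'M[R[i]]_d -> R[i]) A :
  value_assignment O l -> observable A -> O A -> l A = 1 \/ l A = -1.
Proof.
move=> lP obsA OA.
(* A is jointly measurable with itself, so [l A] is one of its eigenvalues. *)
have [psi [psi0 eig]] := lP A A OA (gen_inferable obsA OA) (erefl _).
by apply: (observable_col_eigen obsA psi0); apply: eig; left; left.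
Qed.

(** * Iterated sums of edges *)

Section OplusSeq.
Variables (O : set 'M[R[i]]_d) (T : set 'M[R[i]]_d -> 'M[R[i]]_d).
Hypotheses (ON : forall A, O A -> O (- A)).
Hypotheses (Tmem : forall a, edges O a -> a (T a)).

Lemma oplus_seq_map (f : set 'M[R[i]]_d -> set 'M[R[i]]_d) s c :
    (forall a b c, oplus O T a b c -> oplus O T (f a) (f b) (f c)) ->
  oplus_seq O T s c -> oplus_seq O T (map f s) (f c).
Proof.
move=> fP; elim: s c => [//|a [|b s] IH] c /=; first by move->.
by move=> [e /IH ebs ace]; exists (f e) => //; apply: fP.
Qed.

(** Each partial sum fixes the representative of its result only up to sign; these signs combine
    into a single one. *)
Lemma oplus_seq_rep s c :
    (forall a, a \in s -> gen_edges O T a) -> oplus_seq O T s c ->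
  edges O c /\ (T c = \prod_(a <- s) T a \/ T c = - \prod_(a <- s) T a).
Proof.
elim: s c => [//|a [|b s] IH] c sE.
  by move=> /= ->; rewrite big_seq1; split; [case: (sE a (mem_head _ _))|left].
move=> [e es [_ _ cE _ cT]].
have [|_ eT] := IH e _ es; first by move=> x xs; apply: sE; rewrite inE xs orbT.
split=> //; rewrite big_cons.
by case: cT eT => -> [] ->; rewrite ?mulmxN ?opprK; [left|right|right|left].
Qed.

Lemma oplus_seq_inferable s c :
    (forall a, a \in s -> gen_edges O T a) -> oplus_seq O T s c ->
  inferable O (\prod_(a <- s) T a).
Proof.
move=> sE /(oplus_seq_rep sE) [cE cT].
have infc : inferable O (T c) by exact: inferable_rep.
case: cT infc => -> //; move/(inferableN ON); by rewrite opprK.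
Qed.

(** Induction on the factors: the head lies in O and the product of the rest is inferable, so
    multiplicativity applies to this pair. The product is evaluated directly rather than through
    [T c], so no sign appears. *)
Lemma value_oplus_seq (l : 'M[R[i]]_d -> R[i]) s c :
    value_assignment O l -> (forall a, a \in s -> gen_edges O T a) ->
  oplus_seq O T s c -> l (\prod_(a <- s) T a) = \prod_(a <- s) l (T a).
Proof.
move=> lP; elim: s c => [//|a [|b s] IH] c sE; first by rewrite !big_seq1.
have sE' x : x \in b :: s -> gen_edges O T x.
  by move=> xs; apply: sE; rewrite inE xs orbT.
move=> [e]; rewrite -/(oplus_seq O T (b :: s) e) => es [_ _ _ comm _].
rewrite big_cons [RHS]big_cons -(IH e sE' es).
apply: (value_assignmentM lP).
- by case: (sE a (mem_head _ _)).
- exact: oplus_seq_inferable es.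
(* Commutation is known for [T e], which is the remaining product up to a sign, and that sign
   cancels. *)
have [_ eT] := oplus_seq_rep sE' es.
by case: eT comm => ->; rewrite // /comm_mx mulNmx mulmxN => /oppr_inj.
Qed.

End OplusSeq.

End Observables.

(** * Signs with exponents in Z_2 *)

Lemma signr_Z2D (K : pzRingType) (x y : 'Z_2) :
  (-1) ^+ (x + y)%R = (-1) ^+ x * (-1) ^+ y :> K.
Proof. by rewrite -exprD /= modn2 signr_odd. Qed.

Lemma signr_Z2_sum (K : pzRingType) (I : Type) (s : seq I) (f : I -> 'Z_2) :
  (-1) ^+ (\sum_(i <- s) f i)%R = \prod_(i <- s) (-1) ^+ f i :> K.
Proof.
by apply: (big_morph (fun x : 'Z_2 => (-1) ^+ x)); first exact: signr_Z2D.
Qed.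

(** Turns the success probability for a definite outcome parity into the indicator of a correct
    output. *)
Lemma half_signrZ2 (K : numFieldType) (x y : 'Z_2) :
  2^-1 * (1 + (-1) ^+ x * (-1) ^+ y) = (x == y)%:R :> K.
Proof.
have h : 2^-1 * (1 + 1) = 1 :> K by rewrite -(natrD _ 1 1) mulVf ?pnatr_eq0.
case: x y => [[|[|//]] ?] [[|[|//]] ?]; rewrite !(expr0, expr1) /=;
  by rewrite ?mulr1 ?mul1r ?mulrN1 ?opprK ?subrr ?mulr0 ?h.
Qed.

(** * Success probability of a hidden variable model *)

Section Contextuality.
Variables (R : realType) (d : nat) (H : groupType) (Q : finGroupType).
Variable MB : hmbqc R d H Q.
Local Notation qact := (Defs.qact MB).

Definition output_obs (q : Q) : 'M[R[i]]_d :=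
  \prod_(a <- measured MB) rep MB (qact q a).

Lemma gen_oppr A : gen MB A -> gen MB (- A).
Proof. by move/gen_opp. Qed.

Lemma measured_qact (q : Q) :
  exists c, oplus_seq (gen MB) (rep MB) (map (qact q) (measured MB)) c.
Proof.
have [e eP] := measured_oplus MB; exists (qact q e).
by apply: oplus_seq_map eP => a b c; apply: qact_oplus.
Qed.

Lemma measured_qact_gen (q : Q) a : a \in map (qact q) (measured MB) ->
  gen_edges (gen MB) (rep MB) a.
Proof. by move=> /mapP [b bm ->]; apply/qact_gen/measured_gen. Qed.

Lemma output_obs_inferable (q : Q) : inferable (gen MB) (output_obs q).
Proof.
have [c cP] := measured_qact q.
rewrite /output_obs -(big_map (qact q) xpredT (rep MB)).
apply: oplus_seq_inferable cP; [exact: gen_oppr|exact: rep_mem|].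
exact: measured_qact_gen.
Qed.

(** Values on O are signs, so encoding 1 as the bit 0 and -1 as the bit 1 loses nothing; the product
    of the signs then becomes the parity of the bits. *)
Lemma value_output_obs (l : 'M[R[i]]_d -> R[i]) (q : Q) :
    value_assignment (gen MB) l ->
  l (output_obs q) =
    (-1) ^+ output_parity MB (fun a => if l (rep MB a) == 1 then 0 else 1) q.
Proof.
move=> lP; have [c cP] := measured_qact q.
rewrite /output_obs /output_parity signr_Z2_sum.
rewrite -(big_map (qact q) xpredT (rep MB)).
rewrite (value_oplus_seq gen_oppr (@rep_mem _ _ _ _ MB) lP _ cP); last first.
  exact: measured_qact_gen.
rewrite big_map !big_seq; apply: eq_bigr => a am.
have [_ ga] := measured_qact_gen (map_f (qact q) am).
have [->|->] := value_assignment_sign lP (gen_observable ga) ga.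
  by rewrite eqxx.
(* The value -1 gets the bit 1 because it differs from 1, that is, 2 is nonzero. *)
by rewrite eq_sym -subr_eq0 opprK -(natrD _ 1 1) pnatr_eq0.
Qed.

Lemma hamming_star_le (s : set 'M[R[i]]_d -> 'Z_2) :
  (hamming_star MB <= hamming (outfun MB) (output_parity MB s))%N.
Proof.
rewrite /hamming_star; case: ex_minnP => k _; apply.
apply/asboolP; exists 0, s; congr hamming.
by apply/funext => q; rewrite addr0.
Qed.

Lemma sum_success (o o' : Q -> 'Z_2) :
  \sum_q (o q == o' q)%:R = #|Q|%:R - (hamming o o')%:R :> R.
Proof.
rewrite /hamming -(cardC [pred q | o q != o' q]) natrD addrAC subrr add0r.
rewrite -sum1_card natr_sum [RHS]big_mkcond /=; apply: eq_bigr => q _.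
by rewrite !inE negbK; case: eqP.
Qed.

Lemma avg_successE :
  avg_success MB = #|Q|%:R^-1 * \sum_q 2^-1 *
    (1 + (-1) ^+ outfun MB q * complex.Re (\tr (output_obs q *m rho MB))).
Proof.
rewrite /avg_success; congr (_ * _); apply: eq_bigr => q _.
have [_ _ tr1] := rho_state MB.
rewrite -scalemxAr linearZ /= mulmxDr mulmx1 linearD /= tr1 -scalemxAr.
rewrite linearZ /= mxtrace_mulC -/(output_obs q).
(* The factor 1/2 and the sign are real, so they can be pulled out of [Re]. *)
have -> : (2^-1 : R[i]) = (2^-1 : R)%:C%C by rewrite fmorphV rmorph_nat.
have -> (n : nat) : (-1) ^+ n = ((-1) ^+ n : R)%:C%C by rewrite rmorph_sign.
by case: (\tr _) => x y /=; rewrite !mul0r !subr0.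
Qed.

Lemma avg_success_ncHVM (Omega : choiceType) (p : Omega -> R)
    (l : Omega -> 'M[R[i]]_d -> R[i]) :
  is_ncHVM MB p l -> avg_success MB <= 1 - (hamming_star MB)%:R / #|Q|%:R.
Proof.
move=> [p0 p1 lP trP].
have Q0 : 0 < #|Q|%:R :> R by rewrite ltr0n (cardD1 1%g) inE.
pose par nu := output_parity MB (fun a => if l nu (rep MB a) == 1 then 0 else 1).
have lobs nu q : l nu (output_obs q) = ((-1) ^+ par nu q : R)%:C%C.
  by rewrite value_output_obs ?rmorph_sign //; apply: lP.
have trq q : has_sum (fun nu => (-1) ^+ par nu q * p nu)
    (complex.Re (\tr (output_obs q *m rho MB))).
  have /has_sum_Re := trP _ (output_obs_inferable q).
  congr has_sum; apply/funext => nu.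
  by rewrite lobs -rmorphM.
(* The constant 1 is expanded as the total mass of [p], so that the whole expression becomes one sum
   over the hidden variables. *)
have succ : has_sum
    (fun nu => \sum_q 2^-1 *
      (p nu + (-1) ^+ outfun MB q * ((-1) ^+ par nu q * p nu)))
    (\sum_q 2^-1 *
      (1 + (-1) ^+ outfun MB q * complex.Re (\tr (output_obs q *m rho MB)))).
  apply: has_sum_sum => q; apply: has_sumZ; apply: has_sumD => //.
  exact: has_sumZ.
have bound : has_sum (fun nu => (#|Q|%:R - (hamming_star MB)%:R) * p nu)
    ((#|Q|%:R - (hamming_star MB)%:R) * 1) by exact: has_sumZ.
rewrite avg_successE mulrC ler_pdivrMr // mulrBl mul1r divfK ?gt_eqF //.
rewrite -[leRHS]mulr1; apply: ler_has_sum succ bound => nu.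
(* For fixed [nu] the inner sum is [p nu] times the number of inputs on which [par nu] agrees with
   the output function. *)
rewrite (eq_bigr (fun q => (outfun MB q == par nu q)%:R * p nu)) => [|q _].
  rewrite -mulr_suml sum_success ler_wpM2r // lerD2l lerN2 ler_nat.
  exact: hamming_star_le.
by rewrite -half_signrZ2 -mulrA mulrDl mul1r mulrA.
Qed.

End Contextuality.

Theorem theorem7 (R : realType) (d : nat) (H : groupType) (Q : finGroupType)
    (MB : hmbqc R d H Q) :
  1 - (hamming_star MB)%:R / #|Q|%:R < avg_success MB -> contextual MB.
Proof.
move=> lt_avg [Omega [p [l /avg_success_ncHVM le_avg]]].
by move: lt_avg; rewrite ltNge le_avg.
Qed.
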